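(* Let $K$ be a compact subset of $(0,1)^2$, and let $0\le Y<\infty$. For every $\epsilon>0$ with $\epsilon<\inf_{(p,q)\in K}x_*(p,q)$, there exist constants $C<\infty$ and $0<\theta<1$ such that $$|G_h(x,y,p,q)|\le C\theta^h$$ uniformly for all $h\ge1$, all $(p,q)\in K$, all complex $y$ with $|y|\le Y$, and all complex $x$ with $|x|\le x_*(p,q)-\epsilon$.
   Context: For $h\ge0$, $P_h(X,Q)=\sum_{m=0}^{\lfloor h/2\rfloor}(-X)^mQ^{m(m-1)}\begin{bmatrix} h-m \\ m \end{bmatrix}_Q$, where $\begin{bmatrix} N \\ m \end{bmatrix}_Q$ is the Gaussian binomial polynomial in $Q$ (so $P_0=P_1=1$). Put $D_h(X,Q)=\dfrac{P_h(QX,Q)}{P_{h+1}(X,Q)}$, a rational function of $X$ (it is the generating function of Dyck paths of height at most $h$, with $X$ marking semi-length and $Q$ marking diamond area). For $h\ge1$, $$G_h(x,y,p,q)=x^hy^hq^{h^2}\left[\prod_{k=1}^{h-1}D_k\!\left(q^{2k-1}px,\tfrac{p^2}{q^2}\right)\right]^2D_h\!\left(q^{2h-1}px,\tfrac{p^2}{q^2}\right),$$ with the empty product equal to one, viewed as a rational function of $x$. (It is the generating function of Dyck paths of height exactly $h$, with $x,y,p,q$ marking semi-length, height, water capacity and proper area respectively.) For $r>0$ and $h\ge1$, $A_h(r)$ is the $h\times h$ real symmetric tridiagonal matrix with zero diagonal and $(A_h(r))_{i,i+1}=(A_h(r))_{i+1,i}=r^{(i-1)/2}$ for $1\le i\le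 h-1$; $\lambda_h(r)$ is its spectral radius and $\Lambda_h(r)=\lambda_h(r)^2$. For $p,q>0$ and $k\ge1$ put $$x_k(p,q)=\frac{1}{p^{2k-1}q\,\Lambda_{k+1}(q^2/p^2)},$$ which is the smallest positive real zero in $x$ of $P_{k+1}(p^{2k-1}qx,q^2/p^2)$. For $0<p,q<1$ put $x_*(p,q)=\min_{k\ge1}x_k(p,q)$ (the minimum is attained). *)

(* Defs.v *)
From HB Require Import structures.
From mathcomp Require Import all_boot all_order all_algebra.
From mathcomp Require Import complex.
From mathcomp Require Import all_classical all_reals all_analysis.

Set Implicit Arguments.
Unset Strict Implicit.
Unset Printing Implicit Defensive.

Import Order.TTheory GRing.Theory Num.Theory.
Import numFieldNormedType.Exports.

Local Open Scope classical_set_scope.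
Local Open Scope ring_scope.

(* Value at Q of the Gaussian binomial polynomial, through the q-Pascal rule,
   which makes sense for every Q (roots of unity included); see [gaussbinE]
   for the usual product formula. *)
Fixpoint gaussbin (R : comNzRingType) (Q : R) (N m : nat) : R :=
  match N, m with
  | _, 0 => 1
  | 0, _.+1 => 0
  | N'.+1, m'.+1 => gaussbin Q N' m' + Q ^+ m'.+1 * gaussbin Q N' m'.+1
  end.

Lemma gaussbinE (R : comNzRingType) (Q : R) (N m : nat) :
  gaussbin Q N m * \prod_(i < m) (1 - Q ^+ i.+1) =
  \prod_(i < m) (1 - Q ^+ (N - i)).
Proof.
elim: N m => [|N IHN] [|m]; rewrite ?big_ord0 ?mulr1 //=.
  by rewrite mul0r big_ord_recl /= expr0 subrr mul0r.
rewrite mulrDl -mulrA IHN big_ord_recr /= [in LHS]mulrA IHN.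
rewrite big_ord_recr [RHS]big_ord_recl /= subn0.
have -> : \prod_(i < m) (1 - Q ^+ (N.+1 - bump 0 i)) =
          \prod_(i < m) (1 - Q ^+ (N - i)).
  by apply: eq_bigr => i _; rewrite /bump add1n subSS.
have [lemN|ltNm] := leqP m N; last first.
  by rewrite (bigD1 (Ordinal ltNm)) //= subnn expr0 subrr !(mul0r, mulr0, addr0).
have -> : Q ^+ N.+1 = Q ^+ m.+1 * Q ^+ (N - m) by rewrite -exprD addSn subnKC.
rewrite mulrCA -mulrDr mulrC; congr (_ * _).
by rewrite mulrBr mulr1 addrA subrK.
Qed.

Definition dyckP (R : comNzRingType) (h : nat) (X Q : R) : R :=
  \sum_(m < h./2.+1) (- X) ^+ m * Q ^+ (m * (m - 1)) * gaussbin Q (h - m) m.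

Definition dyckD (F : fieldType) (h : nat) (X Q : F) : F :=
  dyckP h (Q * X) Q / dyckP h.+1 X Q.

(* Over an arbitrary field F, so that x can be the indeterminate of a field of
   rational functions. *)
Definition dyckG (F : fieldType) (h : nat) (x y p q : F) : F :=
  x ^+ h * y ^+ h * q ^+ (h ^ 2)%N *
  (\prod_(1 <= k < h)
     dyckD k (q ^+ (2 * k - 1) * p * x) (p ^+ 2 / q ^+ 2)) ^+ 2 *
  dyckD h (q ^+ (2 * h - 1) * p * x) (p ^+ 2 / q ^+ 2).

Definition ratfun_const (F : fieldType) (c : F) : {fraction {poly F}} :=
  tofrac c%:P.

Definition ratfun_var (F : fieldType) : {fraction {poly F}} :=
  tofrac ('X : {poly F}).

(* f is regular at a (it has no pole there) and takes the value v. *)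
Definition ratfun_value (F : fieldType) (f : {fraction {poly F}}) (a v : F)
    : Prop :=
  exists n d : {poly F},
    [/\ d.[a] != 0, f = tofrac n / tofrac d & v = n.[a] / d.[a]].

Lemma ratfun_value_uniq (F : fieldType) (f : {fraction {poly F}}) (a v w : F) :
  ratfun_value f a v -> ratfun_value f a w -> v = w.
Proof.
move=> [n1 [d1 [d1a -> ->]]] [n2 [d2 [d2a + ->]]].
have nz (d : {poly F}) : d.[a] != 0 -> tofrac d != 0.
  by move=> da; rewrite tofrac_eq0; apply: contraNneq da => ->; rewrite horner0.
move/eqP; rewrite eqr_div ?nz // -!tofracM tofrac_eq => /eqP e.
by apply/eqP; rewrite eqr_div // -!hornerM e.
Qed.

Definition ratfunG (F : fieldType) (h : nat) (y p q : F) : {fraction {poly F}} :=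
  dyckG h (ratfun_var F) (ratfun_const y) (ratfun_const p) (ratfun_const q).

(* Indices start at 0: the entry r^((i-1)/2) of the usual 1-based numbering is
   r^(i/2) here. *)
Definition dyckA (R : realType) (h : nat) (r : R) : 'M[R]_h :=
  \matrix_(i, j) (if j == i.+1 :> nat then r `^ (i%:R / 2)
                  else if i == j.+1 :> nat then r `^ (j%:R / 2)
                  else 0).

Definition spectral_radius (R : realType) (n : nat) (A : 'M[R]_n) : R :=
  sup [set t : R | exists2 z : R[i],
         eigenvalue (map_mx (real_complex R) A) z & `|z| = real_complex R t].

Definition dyckLambda (R : realType) (h : nat) (r : R) : R :=
  spectral_radius (dyckA h r) ^+ 2.

Definition xk (R : realType) (k : nat) (p q : R) : R :=
  (p ^+ (2 * k - 1) * q * dyckLambda k.+1 (q ^+ 2 / p ^+ 2))^-1.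

Definition xstar (R : realType) (p q : R) : R :=
  inf [set xk k p q | k in [set k : nat | (1 <= k)%N]].

(* Main.v *)
(* Let T_0 = T_1 = 1 and T_(n+2) = T_(n+1) - a_n T_n with weights a_i = z r^i,
   where r = q^2 / p^2 and z = p^(2k-1) q x.  The k-th factor of G_h is
   D_k = T_k / T_(k+1), and a root of T_(k+1) in x yields an eigenvalue of
   A_(k+1)(r), so that T_0, ..., T_(k+1) are positive on [0, x_k).  In the
   continued fraction D_k = 1 / (1 - a_(k-1) T_(k-1) / T_k) one has
   a_(k-1) T_(k-1) / T_k < 1 at x' = x_* - eps / 2, so that this quantity is at
   most sigma = (x_* - eps) / x' in modulus when |x| <= sigma x'.  Hence
   |D_k| <= 1 / (1 - sigma) = 2 x' / eps, which is bounded on K since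
   x' < x_1 = 1 / (p q), and the factor q^(h^2) of G_h beats any geometric
   growth. *)
Require Import Defs.
From HB Require Import structures.
From mathcomp Require Import all_boot all_order all_algebra.
From mathcomp Require Import complex polyrcf zify ring lra.
From mathcomp Require Import all_classical all_reals all_analysis.

Set Implicit Arguments.
Unset Strict Implicit.
Unset Printing Implicit Defensive.

Import Order.TTheory GRing.Theory Num.Theory.
Import numFieldNormedType.Exports.

Local Open Scope classical_set_scope.
Local Open Scope ring_scope.

(** * Recurrence for [dyckP] and its three-term form *)

Lemma gaussbin0 (R : comNzRingType) (Q : R) N : gaussbin Q N 0 = 1.
Proof. by case: N. Qed.

Lemma gaussbin_small (R : comNzRingType) (Q : R) N m :
  (N < m)%N -> gaussbin Q N m = 0.
Proof.
elim: N m => [|N IHN] [|m] //= ltNm.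
by rewrite !IHN ?mulr0 ?addr0 // ltnW.
Qed.

(** Beyond [h./2] one has [h - m < m], so the extra Gaussian binomials vanish. This puts the three
    sums of [dyckP_rec] on matching ranges. *)
Lemma dyckP_widen (R : comNzRingType) (h N : nat) (X Q : R) : (h./2 < N)%N ->
  dyckP h X Q =
  \sum_(m < N) (- X) ^+ m * Q ^+ (m * (m - 1)) * gaussbin Q (h - m) m.
Proof.
move=> ltN; pose F m := (- X) ^+ m * Q ^+ (m * (m - 1)) * gaussbin Q (h - m) m.
rewrite /dyckP (big_ord_widen N F ltN) [RHS](bigID (fun m : 'I_N => (m < h./2.+1)%N)) /=.
rewrite [X in _ = _ + X]big1 ?addr0 // => m; rewrite -leqNgt => hm.
by rewrite gaussbin_small ?mulr0 //; lia.
Qed.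

(** The q-Pascal rule splits the term of index [m.+1]: its second summand is the term of the same
    index in the sum at [Q * X], its first one is [- X] times the term of index [m] in the sum at
    [Q ^+ 2 * X]. *)
Lemma dyckP_rec (R : comNzRingType) (h : nat) (X Q : R) :
  dyckP h.+2 X Q = dyckP h.+1 (Q * X) Q - X * dyckP h (Q ^+ 2 * X) Q.
Proof.
rewrite (@dyckP_widen _ h.+2 h.+2) ?(@dyckP_widen _ h.+1 h.+2); try lia.
rewrite (@dyckP_widen _ h h.+1); last lia.
rewrite big_ord_recl [in RHS]big_ord_recl !gaussbin0 -addrA; congr (_ + _).
rewrite mulr_sumr -sumrN -big_split; apply: eq_bigr => m _.
have lem : (m <= h)%N by rewrite -ltnS.
rewrite !lift0 !subSS !subn0 subSn //=.
have -> : Q ^+ (m.+1 * m) = Q ^+ m * Q ^+ m * Q ^+ (m * (m - 1)).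
  by rewrite -!exprD; congr (_ ^+ _); case: (val m) => [|k] //=; rewrite subn1 /=; lia.
rewrite -[X in _ - X * _]opprK -!mulrN; move: (- X) => Z.
rewrite !exprMn !exprS. ring.
Qed.

(** The continuant T_n: the determinant of the tridiagonal matrix of size [n] with unit diagonal
    whose pairs of opposite off-diagonal entries have products a_0, ..., a_(n-2). *)
Fixpoint tridet (R : comNzRingType) (a : nat -> R) (n : nat) : R :=
  if n is n1.+1 then
    if n1 is n2.+1 then tridet a n1 - a n2 * tridet a n2 else 1
  else 1.

Lemma tridetSS (R : comNzRingType) (a : nat -> R) n :
  tridet a n.+2 = tridet a n.+1 - a n * tridet a n.
Proof. by []. Qed.

Lemma nat_ind2 (P : nat -> Prop) :
  P 0%N -> P 1%N -> (forall n, P n -> P n.+1 -> P n.+2) -> forall n, P n.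
Proof.
move=> P0 P1 PSS n; suff [] : P n /\ P n.+1 by [].
by elim: n => [|n [Pn PSn]]; split=> //; apply: PSS.
Qed.

Lemma eq_tridet (R : comNzRingType) (a b : nat -> R) n :
  a =1 b -> tridet a n = tridet b n.
Proof.
by move=> eab; elim/nat_ind2: n => // n IH1 IH2; rewrite !tridetSS IH1 IH2 eab.
Qed.

Lemma rmorph_tridet (R S : comNzRingType) (f : {rmorphism R -> S}) a n :
  f (tridet a n) = tridet (f \o a) n.
Proof.
elim/nat_ind2: n => [||n IH1 IH2]; rewrite ?rmorph1 //.
by rewrite !tridetSS rmorphB rmorphM IH1 IH2.
Qed.

(** Along [c], multiplication by [Q] lowers the index by one, so the rescaled arguments in
    [dyckP_rec] become the previous terms of a single sequence. *)
Lemma dyckP_tridet (R : comNzRingType) (Q : R) (c : nat -> R) n :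
  (forall i, c i = Q * c i.+1) ->
  dyckP n (c n) Q = tridet (fun i => c i.+2) n.
Proof.
move=> cQ; elim/nat_ind2: n => [||n IH1 IH2].
- by rewrite /dyckP big_ord1 expr0 !mul1r.
- by rewrite /dyckP big_ord1 expr0 !mul1r.
by rewrite dyckP_rec expr2 -mulrA -!cQ IH1 IH2.
Qed.

(** * Positivity before the first root *)

(** Interlacing: the first positive root of T_(n+2) never comes after that of T_(n+1), so the
    absence of roots passes down to lower indices. As T_i is 1 at 0, the intermediate value theorem
    turns it into positivity. *)
Lemma tridet_gt0 (R : rcfType) (w : nat -> R) (n : nat) (z0 : R) :
  (forall i, 0 < w i) -> 0 <= z0 ->
  (forall z, 0 < z <= z0 -> tridet (fun i => w i * z) n != 0) ->
  forall i, (i <= n)%N -> 0 < tridet (fun i => w i * z0) i.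
Proof.
move=> w_gt0.
pose T i := tridet (fun i => (w i)%:P * 'X : {poly R}) i.
have TE i z : (T i).[z] = tridet (fun i => w i * z) i.
  rewrite -horner_evalE rmorph_tridet; apply: eq_tridet => j /=.
  by rewrite horner_evalE hornerM hornerC hornerX.
have T0 i : (T i).[0] = 1.
  by rewrite TE; elim/nat_ind2: i => // i _ IH; rewrite tridetSS IH mulr0 mul0r subr0.
have pos (i : nat) (z1 : R) : 0 <= z1 ->
    (forall z, 0 < z <= z1 -> tridet (fun i => w i * z) i != 0) -> 0 < (T i).[z1].
  move=> z1_ge0 nz; rewrite ltNge; apply/negP => le0.
  have [|z /andP[z_ge0 lez] /rootP z_root] := @poly_ivtW _ (- T i) 0 z1 z1_ge0.
    by rewrite !hornerN T0 oppr_le0 ler01 oppr_ge0.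
  move: z_root; rewrite hornerN => /eqP; rewrite oppr_eq0 => /eqP z_root.
  have z_gt0 : 0 < z.
    rewrite lt_neqAle z_ge0 andbT; apply: contra_eq_neq z_root => <-.
    by rewrite T0 oner_neq0.
  by have := nz z; rewrite z_gt0 lez -TE z_root eqxx => /(_ isT).
elim: n z0 => [|n IHn] z0 z0_ge0 nz i; first by rewrite leqn0 => /eqP ->.
rewrite leq_eqVlt => /predU1P[->|]; first by rewrite -TE pos.
rewrite ltnS; apply: (IHn) => // z /andP[z_gt0 lez]; apply/negP => /eqP z_root.
case: n IHn nz z_root => [_ _ /eqP|n IHn nz z_root]; first by rewrite oner_eq0.
(* At the first positive root y of T_(n+1), T_(n+2) = - w_n y T_n <= 0, so that
   T_(n+2) has a root in (0, y]. *)
have [y [y_gt0 lez' y_root y_first]] : exists y, [/\ 0 < y, y <= z,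
    (T n.+1).[y] = 0 & forall x, 0 < x < y -> (T n.+1).[x] != 0].
  have T_neq0 : T n.+1 != 0.
    by apply: contraTneq (oner_neq0 R) => TO; rewrite -(T0 n.+1) TO horner0 eqxx.
  case: (next_rootP (T n.+1) 0 z) => [T_eq0|y _ yT0 yz nroot|c _ _ nroot].
  - by rewrite T_eq0 eqxx in T_neq0.
  - move: yz; rewrite in_itv /= => /andP[y_gt0 ltyz].
    by exists y; split=> //; exact: ltW.
  - by exists z; split=> //; rewrite TE.
(* A negative value would give T_n a root strictly before [y], where the induction hypothesis makes
   it positive. *)
have T_ge0 : 0 <= (T n).[y].
  rewrite leNgt; apply/negP => lt0.
  have [|x /andP[x_ge0 lexy] /rootP x_root] := @poly_ivtW _ (- T n) 0 y (ltW y_gt0).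
    by rewrite !hornerN T0 oppr_le0 ler01 oppr_ge0 ltW.
  move: x_root; rewrite hornerN => /eqP; rewrite oppr_eq0 => /eqP x_root.
  have ltxy : x < y.
    by rewrite lt_neqAle lexy andbT; apply: contraTneq lt0 => <-; rewrite x_root ltxx.
  have := IHn x x_ge0 _ n (leqnSn n); rewrite -TE x_root ltxx => H.
  have // : false; apply: H => u /andP[u_gt0 leux].
  by rewrite -TE y_first // u_gt0 (le_lt_trans leux).
have := pos n.+2 y (ltW y_gt0) => /(_ _).
rewrite TE tridetSS -!TE y_root sub0r oppr_gt0 pmulr_rlt0 ?mulr_gt0 // ltNge T_ge0 /= => H.
have // : false; apply: H => u /andP[u_gt0 leux].
by rewrite nz // u_gt0 (le_trans leux) // (le_trans lez').
Qed.

(** * From roots of continuants to eigenvalues and x_k *)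

(** With t = sqrt s, opposite entries of t A_n have products r^i s, so the continuant is det(1 - t
    A_n). An explicit eigenvector for 1/t replaces the expansion of this determinant. *)
Lemma dyckA_eigenvalue (R : realType) (r s : R) (n : nat) : 0 < r -> 0 < s ->
  tridet (fun i => r ^+ i * s) n = 0 -> eigenvalue (dyckA n r) (Num.sqrt s)^-1.
Proof.
move=> r_gt0 s_gt0 Tn0.
set t := Num.sqrt s; pose b l : R := r `^ (l%:R / 2).
pose T := tridet (fun i => r ^+ i * s).
pose c i : R := \prod_(l < i) (t * b l).
have t_gt0 : 0 < t by rewrite sqrtr_gt0.
have b_gt0 l : 0 < b l by rewrite powR_gt0.
have c_gt0 i : 0 < c i by apply: prodr_gt0 => l _; rewrite mulr_gt0.
have cS i : c i.+1 = c i * (t * b i) by rewrite /c big_ord_recr.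
have bE l : b l ^+ 2 = r ^+ l.
  by rewrite -powR_mulrn ?powR_ge0 // -powRrM divfK ?pnatr_eq0 // powR_mulrn // ltW.
case: n Tn0 => [/eqP|n Tn0]; first by rewrite oner_eq0.
(* the orthogonal polynomials, normalised, are the coordinates of an eigenvector *)
pose u i := T i / c i.
(* The recurrence at the last coordinate involves [u n.+1], which lies outside the vector; the root
   condition makes it vanish. *)
have un0 : u n.+1 = 0 by rewrite /u [T _]Tn0 mul0r.
apply/eigenvalueP; exists (\row_i u i); last first.
  apply/eqP => /rowP /(_ ord0); rewrite !mxE /u /c big_ord0 divr1 => /eqP.
  by rewrite oner_eq0.
apply/rowP => j; rewrite !mxE.
transitivity (\sum_(i < n.+1) (if i.+1 == j :> nat then u i * b i else 0)
            + \sum_(i < n.+1) (if i == j.+1 :> nat then u i * b j else 0)).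
  rewrite -big_split /=; apply: eq_bigr => i _; rewrite !mxE eq_sym.
  case: eqP => [ij|_]; last by case: eqP => _; rewrite add0r // mulr0.
  by rewrite -ij ltn_eqF ?addr0.
rewrite -[X in _ + X]big_mkcond (big_ord1_eq _ (fun i => u i * b j)).
have -> : (if (j.+1 < n.+1)%N then u j.+1 * b j else 0) = u j.+1 * b j.
  case: ltnP => // lenj; have -> : j.+1 = n.+1 by apply/eqP; rewrite eqn_leq ltn_ord.
  by rewrite un0 mul0r.
case: j => -[|j] /= ltj.
  rewrite big1 // add0r /u /c big_ord0 big_ord1 /T /=; field.
  by rewrite !gt_eqF.
rewrite -[X in X + _]big_mkcond /=.
under eq_bigl do rewrite eqSS.
rewrite (big_ord1_eq _ (fun i => u i * b i)) ltnW //.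
rewrite /u !cS /T tridetSS -bE -(sqr_sqrtr (ltW s_gt0)) -/t; field.
by rewrite !gt_eqF.
Qed.

(** [sup] dominates the members of a set only if the set is bounded above; the sum of the moduli of
    the roots of the characteristic polynomial is such a bound. *)
Lemma le_spectral_radius (R : realType) (n : nat) (A : 'M[R]_n) (mu : R) :
  0 <= mu -> eigenvalue A mu -> mu <= spectral_radius A.
Proof.
move=> mu_ge0 mu_eig; apply: ub_le_sup; last first.
  exists (real_complex R mu); first by rewrite eigenvalue_map.
  by rewrite ger0_norm // lecR.
set chi := char_poly (map_mx (real_complex R) A).
have [rs chiE] := closed_field_poly_normal chi.
exists (\sum_(z <- rs) Normc.normc z) => t [z z_eig zt].
have z_rs : z \in rs.
  move: z_eig; rewrite eigenvalue_root_char -/chi chiE.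
  rewrite rootZ ?root_prod_XsubC // lead_coef_eq0.
  by rewrite -size_poly_eq0 size_char_poly.
have -> : t = Normc.normc z by apply: complexI; rewrite -zt.
rewrite (big_rem _ z_rs) /= lerDl; apply: sumr_ge0 => w _.
by rewrite -lecR; exact: (normr_ge0 w).
Qed.

(** At a root [x], 1 / sqrt(x w) is an eigenvalue, so 1 / (x w) is at most Lambda_(k+1); it remains
    to invert. *)
Lemma xk_le (R : realType) (k : nat) (p q x : R) : 0 < p -> 0 < q -> 0 < x ->
  tridet (fun i => (q ^+ 2 / p ^+ 2) ^+ i * (x * (p ^+ (2 * k - 1) * q))) k.+1 = 0 ->
  xk k p q <= x.
Proof.
move=> p_gt0 q_gt0 x_gt0; set w := p ^+ _ * q; set r := q ^+ 2 / p ^+ 2.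
have w_gt0 : 0 < w by rewrite mulr_gt0 ?exprn_gt0.
have r_gt0 : 0 < r by rewrite divr_gt0 ?exprn_gt0.
move=> /(dyckA_eigenvalue r_gt0 (mulr_gt0 x_gt0 w_gt0)) eig.
have sq_gt0 : 0 < Num.sqrt (x * w) by rewrite sqrtr_gt0 mulr_gt0.
have le_rho : (Num.sqrt (x * w))^-1 <= spectral_radius (dyckA k.+1 r).
  by apply: le_spectral_radius => //; rewrite invr_ge0 ltW.
have : (x * w)^-1 <= dyckLambda k.+1 r.
  rewrite -[in leLHS](sqr_sqrtr (ltW (mulr_gt0 x_gt0 w_gt0))) -exprVn /dyckLambda.
  by rewrite ler_pXn2r ?nnegrE ?invr_ge0 ?(ltW sq_gt0) // (le_trans _ le_rho) ?invr_ge0 ?ltW.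
rewrite /xk -/r -/w => leL.
have L_gt0 : 0 < dyckLambda k.+1 r.
  by rewrite (lt_le_trans _ leL) // invr_gt0 mulr_gt0.
rewrite invf_ple ?posrE ?(mulr_gt0 w_gt0 L_gt0) //.
have -> : x^-1 = w * (x * w)^-1 by field; rewrite !gt_eqF.
by rewrite ler_pM2l.
Qed.

Lemma tridet_xk_gt0 (R : realType) (k : nat) (p q x : R) : 0 < p -> 0 < q ->
  0 <= x < xk k p q -> forall i, (i <= k.+1)%N ->
  0 < tridet (fun i => (q ^+ 2 / p ^+ 2) ^+ i * (x * (p ^+ (2 * k - 1) * q))) i.
Proof.
move=> p_gt0 q_gt0 /andP[x_ge0 ltx].
have w_gt0 : 0 < p ^+ (2 * k - 1) * q by rewrite mulr_gt0 ?exprn_gt0.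
apply: (tridet_gt0 (w := fun i => (q ^+ 2 / p ^+ 2) ^+ i)).
- by move=> i; rewrite exprn_gt0 // divr_gt0 ?exprn_gt0.
- by rewrite mulr_ge0 // ltW.
move=> z /andP[z_gt0 lez]; apply/eqP => Tz0.
suff : xk k p q <= z / (p ^+ (2 * k - 1) * q).
  by apply/negP; rewrite -ltNge (le_lt_trans _ ltx) // ler_pdivrMr.
by apply: xk_le; rewrite ?divr_gt0 // divfK ?gt_eqF.
Qed.

(** * Ratios of consecutive continuants *)

Lemma norm_inv_sub1_le (F : numFieldType) (w e : F) : `|w| <= e -> e < 1 ->
  1 - w != 0 /\ `|(1 - w)^-1| <= (1 - e)^-1.
Proof.
move=> le_we lt_e1; have lt_e : 0 < 1 - e by rewrite subr_gt0.
have le_e : 1 - e <= `|1 - w|.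
  by apply: le_trans (lerB_normD _ _); rewrite normr1 normrN lerD2l lerN2.
have lt_w : 0 < `|1 - w| := lt_le_trans lt_e le_e.
by split; [rewrite -normr_gt0|rewrite normfV lef_pV2].
Qed.

(* With rho_i := T_i / T_(i+1), the recurrence reads rho_(i+1) = 1 / (1 - a_i rho_i),
   which is monotone in the moduli; and a_i rho_i < 1 at the positive weights. *)
Lemma tridet_ratio_le (F : numFieldType) (a b : nat -> F) (sigma : F) (n : nat) :
  0 <= sigma < 1 -> (forall i, 0 <= a i) -> (forall i, `|b i| <= sigma * a i) ->
  (forall i, (i <= n.+1)%N -> 0 < tridet a i) ->
  tridet b n.+1 != 0 /\ `|tridet b n / tridet b n.+1| <= (1 - sigma)^-1.
Proof.
move=> /andP[s_ge0 s_lt1] a_ge0 leba.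
have s1_gt0 : 0 < 1 - sigma by rewrite subr_gt0.
have leab i : `|b i| <= a i by rewrite (le_trans (leba i)) // ler_piMl // ltW.
have step i : 0 < tridet a i.+1 -> 0 < tridet a i.+2 ->
    a i * (tridet a i / tridet a i.+1) < 1.
  move=> p1; rewrite tridetSS subr_gt0 => lt1.
  by rewrite mulrA ltr_pdivrMr // mul1r.
have frac i : tridet b i.+1 != 0 ->
    tridet b i.+2 = tridet b i.+1 * (1 - b i * (tridet b i / tridet b i.+1)).
  by move=> nz; rewrite tridetSS; field.
(* The induction compares the ratios using only |b_i| <= a_i; the gain [sigma] is kept for the last
   step, where it is applied once to a_n rho_n < 1. *)
have key : forall i, (i <= n)%N -> (forall i, (i <= n.+1)%N -> 0 < tridet a i) ->
    tridet b i.+1 != 0 /\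
    `|tridet b i / tridet b i.+1| <= tridet a i / tridet a i.+1.
  elim=> [|i IHi] lei pos.
    by rewrite /= oner_neq0 divr1 normr1.
  have [nz le_rho] := IHi (ltnW lei) pos.
  have p0 : 0 < tridet a i by apply: pos; lia.
  have p1 : 0 < tridet a i.+1 by apply: pos; lia.
  have p2 : 0 < tridet a i.+2 by apply: pos.
  have [|nz' le_inv] := @norm_inv_sub1_le _ (b i * (tridet b i / tridet b i.+1)) _ _ (step i p1 p2).
    by rewrite normrM ler_pM.
  rewrite frac // mulf_neq0 //; split=> //.
  rewrite invfM mulrA divff // mul1r (le_trans le_inv) //.
  rewrite le_eqVlt; apply/orP; left; apply/eqP.
  by rewrite tridetSS; field; rewrite -tridetSS !gt_eqF.
move=> pos; have [nz _] := key n (leqnn n) pos; split=> //.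
case: n key pos nz => [|n] key pos nz.
  by rewrite divr1 normr1 invf_ge1 // lerBlDr lerDl.
have [nz' le_rho] := key n (leqnSn n) pos.
have p1 : 0 < tridet a n.+1 by apply: pos.
have [|_ le_inv] := @norm_inv_sub1_le _ (b n * (tridet b n / tridet b n.+1)) sigma _ s_lt1.
  have lt1 := step n p1 (pos _ (leqnn _)).
  rewrite normrM (le_trans (ler_pM _ _ (leba n) le_rho)) //.
  by rewrite -mulrA ler_piMr // ltW.
by rewrite frac // invfM mulrA divff // mul1r.
Qed.

(** * Evaluation of rational functions *)

Lemma rmorph_dyckP (R S : comNzRingType) (f : {rmorphism R -> S}) h X Q :
  f (dyckP h X Q) = dyckP h (f X) (f Q).
Proof.
have fgb N m : f (gaussbin Q N m) = gaussbin (f Q) N m.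
  elim: N m => [|N IHN] [|m] //=; rewrite ?rmorph0 ?rmorph1 //.
  by rewrite rmorphD rmorphM rmorphXn /= !IHN.
rewrite rmorph_sum; apply: eq_bigr => m _ /=.
by rewrite !rmorphM !rmorphXn rmorphN fgb.
Qed.

Lemma ratfun_value_tofrac (F : fieldType) (n : {poly F}) (a : F) :
  ratfun_value (tofrac n) a n.[a].
Proof. by exists n, 1; rewrite hornerC oner_neq0 tofrac1 !divr1. Qed.

Lemma ratfun_valueM (F : fieldType) (f g : {fraction {poly F}}) (a v w : F) :
  ratfun_value f a v -> ratfun_value g a w -> ratfun_value (f * g) a (v * w).
Proof.
move=> [n1 [d1 [d1a -> ->]]] [n2 [d2 [d2a -> ->]]].
exists (n1 * n2), (d1 * d2).
by rewrite !tofracM !hornerM mulf_neq0 // !mulf_div.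
Qed.

Lemma ratfun_valueX (F : fieldType) (f : {fraction {poly F}}) (a v : F) n :
  ratfun_value f a v -> ratfun_value (f ^+ n) a (v ^+ n).
Proof.
move=> fv; elim: n => [|n IHn]; last by rewrite !exprS; apply: ratfun_valueM.
by rewrite !expr0 -[1 in X in ratfun_value X]tofrac1 -[X in ratfun_value _ _ X](hornerC 1 a);
  apply: ratfun_value_tofrac.
Qed.

(** Regularity passes to products and powers, and each D_k is an explicit quotient of polynomials
    whose denominator takes at [a] the value assumed non-zero. *)
Lemma ratfunG_value (F : fieldType) (h : nat) (y p q a : F) :
  (forall k, (1 <= k <= h)%N ->
     dyckP k.+1 (q ^+ (2 * k - 1) * p * a) (p ^+ 2 / q ^+ 2) != 0) ->
  (1 <= h)%N ->
  ratfun_value (ratfunG h y p q) a (dyckG h a y p q).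
Proof.
move=> nz h_gt0.
have cst (c : F) : ratfun_value (ratfun_const c) a c.
  by rewrite -[X in ratfun_value _ _ X](hornerC c a); apply: ratfun_value_tofrac.
have var : ratfun_value (ratfun_var F) a a.
  by rewrite -[X in ratfun_value _ _ X](hornerX a); apply: ratfun_value_tofrac.
have D k : (1 <= k <= h)%N -> ratfun_value
    (dyckD k (ratfun_const q ^+ (2 * k - 1) * ratfun_const p * ratfun_var F)
             (ratfun_const p ^+ 2 / ratfun_const q ^+ 2)) a
    (dyckD k (q ^+ (2 * k - 1) * p * a) (p ^+ 2 / q ^+ 2)).
  move=> k_in; pose X : {poly F} := (q ^+ (2 * k - 1) * p)%:P * 'X.
  pose Q : {poly F} := (p ^+ 2 / q ^+ 2)%:P.
  have XE : X.[a] = q ^+ (2 * k - 1) * p * a by rewrite hornerM hornerC hornerX.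
  have QE : Q.[a] = p ^+ 2 / q ^+ 2 by rewrite hornerC.
  have PE n Z : (dyckP n Z Q).[a] = dyckP n Z.[a] (p ^+ 2 / q ^+ 2).
    by rewrite -QE -!horner_evalE rmorph_dyckP.
  exists (dyckP k (Q * X) Q), (dyckP k.+1 X Q).
  rewrite !PE XE hornerM XE QE; split=> //; first exact: nz.
  rewrite !rmorph_dyckP rmorphM /=.
  have -> : tofrac X = ratfun_const q ^+ (2 * k - 1) * ratfun_const p * ratfun_var F.
    by rewrite /X !(tofracM, polyCM, rmorphXn).
  have -> // : tofrac Q = ratfun_const p ^+ 2 / ratfun_const q ^+ 2.
  have constE (c : F) : ratfun_const c = (@tofrac {poly F} \o @polyC F) c by [].
  by rewrite !constE -!rmorphXn -fmorph_div.
have prodD : ratfun_value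
    (\prod_(1 <= k < h)
      dyckD k (ratfun_const q ^+ (2 * k - 1) * ratfun_const p * ratfun_var F)
              (ratfun_const p ^+ 2 / ratfun_const q ^+ 2)) a
    (\prod_(1 <= k < h) dyckD k (q ^+ (2 * k - 1) * p * a) (p ^+ 2 / q ^+ 2)).
  rewrite !big_nat; apply: (big_ind2 (fun f v => ratfun_value f a v)).
  (* The empty product is read as the indeterminate to the power 0. *)
  - exact: (ratfun_valueX 0 var).
  - by move=> *; apply: ratfun_valueM.
  - by move=> k /andP[k_gt0 ltkh]; apply: D; rewrite k_gt0 ltnW.
apply: ratfun_valueM; last by apply: D; rewrite h_gt0 leqnn.
apply: ratfun_valueM; last exact: ratfun_valueX.
by do 2?apply: ratfun_valueM; apply: ratfun_valueX.
Qed.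

(** * Bounds on D_k and G_h *)

Lemma dyckD_le (R : realType) (k : nat) (p q x' sigma : R) (x : R[i]) :
  0 < p -> 0 < q -> (1 <= k)%N -> 0 <= x' < xk k p q -> 0 <= sigma < 1 ->
  `|x| <= real_complex R (sigma * x') ->
  let X := real_complex R q ^+ (2 * k - 1) * real_complex R p * x in
  let Q := real_complex R p ^+ 2 / real_complex R q ^+ 2 in
  dyckP k.+1 X Q != 0 /\ `|dyckD k X Q| <= real_complex R (1 - sigma)^-1.
Proof.
move=> p_gt0 q_gt0 k_gt0 x'_lt /andP[s_ge0 s_lt1] le_x X Q.
pose C : {rmorphism R -> R[i]} := real_complex R.
have CE t : real_complex R t = C t by [].
rewrite !CE in le_x X Q *.
have p_neq0 : C p != 0 by rewrite fmorph_eq0 gt_eqF.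
have q_neq0 : C q != 0 by rewrite fmorph_eq0 gt_eqF.
set r := q ^+ 2 / p ^+ 2; set w := p ^+ (2 * k - 1) * q.
have r_gt0 : 0 < r by rewrite divr_gt0 ?exprn_gt0.
have w_gt0 : 0 < w by rewrite mulr_gt0 ?exprn_gt0.
have rE : C r = C q ^+ 2 / C p ^+ 2 by rewrite fmorph_div !rmorphXn.
have r_neq0 : C r != 0 by rewrite fmorph_eq0 gt_eqF.
have QE : Q = (C r)^-1 by rewrite rE invf_div.
(* [c] grows like r^i = Q^-i: the path is read from its other end. *)
pose c i := C r ^+ i * (x * C w) / C r ^+ 2.
have cQ i : c i = Q * c i.+1.
  by rewrite /c QE (exprS _ i); field.
(* This is r^(k-1) p^(2k-1) q = q^(2k-1) p; dividing by r^2 in [c] offsets the shift by two in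
   [dyckP_tridet]. *)
have cX : c k.+1 = X.
  rewrite /c /X /w; case: k k_gt0 {x'_lt X w w_gt0 c cQ} => // k _.
  have -> : (2 * k.+1 - 1 = (2 * k).+1)%N by lia.
  have -> : C r ^+ k.+2 = C q ^+ (2 * k) / C p ^+ (2 * k) * C r ^+ 2.
    by rewrite -addn2 exprD [in C r ^+ k]rE expr_div_n -!exprM.
  rewrite rmorphM rmorphXn !(exprS _ (2 * k)). field.
  by rewrite r_neq0 expf_neq0.
(* The same weights at the real point [x'] and at [x]: [b] is dominated by [sigma] times [a], whose
   continuants are positive because [x'] lies below x_k. *)
pose a i := C (r ^+ i * (x' * w)); pose b i := C r ^+ i * (x * C w).
have bE n : dyckP n (c n) Q = tridet b n.
  rewrite (dyckP_tridet _ cQ); apply: eq_tridet => i.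
  by rewrite /c /b !(exprS _ i.+1, exprS _ i); field.
have [||||b_neq0 le_b] := @tridet_ratio_le _ a b (C sigma) k.
- by rewrite -(rmorph0 C) -(rmorph1 C) -!CE lecR ltcR s_ge0.
- move=> i; rewrite /a -(rmorph0 C) -!CE lecR; case/andP: x'_lt => x'_ge0 _.
  by rewrite !mulr_ge0 ?exprn_ge0 // ltW.
- move=> i; rewrite /a /b !normrM.
  have nC t : 0 < t -> `|C t| = C t by move=> t_gt0; rewrite ger0_norm // -(rmorph0 C) -!CE lecR ltW.
  have -> : C sigma * C (r ^+ i * (x' * w)) = C r ^+ i * (C (sigma * x') * C w).
    by rewrite -rmorphXn -!rmorphM; congr (C _); ring.
  have C_gt0 t : 0 < t -> 0 < C t by rewrite -(rmorph0 C) -!CE ltcR.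
  by rewrite normrX !nC // ler_pM2l ?exprn_gt0 ?C_gt0 // ler_pM2r ?C_gt0.
- move=> i lei; rewrite -(rmorph_tridet C) -(rmorph0 C) -!CE ltcR.
  exact: (tridet_xk_gt0 p_gt0 q_gt0 x'_lt).
rewrite /dyckD -cX -cQ !bE; split=> //.
by rewrite fmorphV rmorphB rmorph1.
Qed.

(** There are 2h - 1 factors D_k, counted with multiplicity; [1 <= M] rounds M^(2h-1) up to (M^2)^h,
    leaving a geometric term times b^(h^2). *)
Lemma dyckG_le (F : numFieldType) (h : nat) (x y p q X Y b M : F) :
  (1 <= h)%N -> `|x| <= X -> `|y| <= Y -> `|q| <= b -> 1 <= M ->
  (forall k, (1 <= k <= h)%N ->
     `|dyckD k (q ^+ (2 * k - 1) * p * x) (p ^+ 2 / q ^+ 2)| <= M) ->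
  `|dyckG h x y p q| <= (X * Y * M ^+ 2) ^+ h * b ^+ (h ^ 2)%N.
Proof.
move=> h_gt0 le_x le_y le_q M_ge1 le_D.
have M_ge0 : 0 <= M := le_trans ler01 M_ge1.
have le_prod : `|\prod_(1 <= k < h) dyckD k (q ^+ (2 * k - 1) * p * x) (p ^+ 2 / q ^+ 2)|
    <= M ^+ (h - 1).
  rewrite normr_prod -prodr_const_nat big_nat [leRHS]big_nat.
  apply: ler_prod => k /andP[k_gt0 ltkh]; rewrite normr_ge0 le_D //.
  by rewrite k_gt0 ltnW.
have le_M : `|\prod_(1 <= k < h) dyckD k (q ^+ (2 * k - 1) * p * x) (p ^+ 2 / q ^+ 2)| ^+ 2
    * `|dyckD h (q ^+ (2 * h - 1) * p * x) (p ^+ 2 / q ^+ 2)| <= (M ^+ 2) ^+ h.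
  have -> : (M ^+ 2) ^+ h = (M ^+ (h - 1)) ^+ 2 * M ^+ 2.
    by rewrite -!exprM -exprD; congr (_ ^+ _); lia.
  apply: ler_pM; rewrite ?exprn_ge0 //.
    by rewrite lerXn2r ?nnegrE ?exprn_ge0.
  apply: (@le_trans _ _ M); first by apply: le_D; rewrite h_gt0 leqnn.
  by rewrite expr2 ler_peMl.
rewrite -normrX -normrM in le_M.
rewrite /dyckG -mulrA normrM.
have -> : (X * Y * M ^+ 2) ^+ h * b ^+ (h ^ 2)%N =
    X ^+ h * Y ^+ h * b ^+ (h ^ 2)%N * (M ^+ 2) ^+ h by rewrite !exprMn; ring.
have pw u v n : `|u| <= v -> `|u| ^+ n <= v ^+ n :> F.
  by move=> uv; rewrite lerXn2r ?nnegrE // (le_trans _ uv).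
have ge0 (u : F) n : 0 <= `|u| ^+ n by rewrite exprn_ge0.
apply: (ler_pM _ _ _ le_M) => //; rewrite !normrM !normrX.
apply: ler_pM; rewrite ?mulr_ge0 ?ge0 ?pw //.
by apply: ler_pM; rewrite ?ge0 ?pw.
Qed.

(** * Uniform constants *)

(** The product is (B b^h)^h. Once B b^N <= 1 it is at most 1 for h >= N, and for h < N it is at
    most (1 + B)^N. *)
Lemma expr_square_bounded (R : realType) (B b : R) : 0 <= B -> 0 <= b < 1 ->
  exists C : R, forall h : nat, B ^+ h * b ^+ (h ^ 2)%N <= C.
Proof.
move=> B_ge0 /andP[b_ge0 b_lt1].
have [N leN] : exists N : nat, B * b ^+ N <= 1.
  have cv : B * b ^+ n @[n --> \oo] --> B * 0.
    by apply: cvgMr; apply: cvg_expr; rewrite ger0_norm.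
  rewrite mulr0 in cv.
  have [N _ NP] := cvgr_le _ cv _ ltr01.
  by exists N; apply: NP => /=.
exists ((1 + B) ^+ N) => h.
have -> : B ^+ h * b ^+ (h ^ 2)%N = (B * b ^+ h) ^+ h.
  by rewrite exprMn -exprM mulnn.
have bh_ge0 : 0 <= b ^+ h by rewrite exprn_ge0.
have B1 : 1 <= 1 + B by rewrite lerDl.
have [leNh|ltNh] := leqP N h.
  apply: (@le_trans _ _ 1); last exact: exprn_ege1.
  apply: exprn_ile1; first exact: mulr_ge0.
  by rewrite (le_trans _ leN) // ler_wpM2l // ler_wiXn2l // ltW.
apply: (@le_trans _ _ ((1 + B) ^+ h)); last by rewrite ler_weXn2l // ltnW.
rewrite lerXn2r ?nnegrE ?mulr_ge0 ?addr_ge0 //.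
rewrite (@le_trans _ _ B) ?lerDr // ler_piMr // exprn_ile1 // ltW //.
Qed.

(** The coordinates attain their extreme values on a non-empty [K], so these values stay strictly
    between 0 and 1. *)
Lemma compact_unit_square_bounds (R : realType) (K : set (R * R)) : compact K ->
  (forall p q : R, K (p, q) -> 0 < p < 1 /\ 0 < q < 1) ->
  exists a b : R, [/\ 0 < a, 0 <= b < 1 &
    forall p q : R, K (p, q) -> [/\ a <= p, a <= q & q <= b]].
Proof.
move=> cK K_sub; have [->|/set0P K0] := eqVneq K set0.
  by exists 1, 0; rewrite ltr01 lexx; split.
have cont1 : {within K, continuous (@fst R R)}.
  by apply: continuous_subspaceT => z; apply: cvg_fst.
have cont2 : {within K, continuous (@snd R R)}.
  by apply: continuous_subspaceT => z; apply: cvg_snd.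
have [[p1 q1] /set_mem K1 min1] := compact_EVT_min K0 cK cont1.
have [[p2 q2] /set_mem K2 min2] := compact_EVT_min K0 cK cont2.
have [[p3 q3] /set_mem K3 max3] := compact_EVT_max K0 cK cont2.
have [/andP[p1_gt0 _] _] := K_sub _ _ K1.
have [_ /andP[q2_gt0 _]] := K_sub _ _ K2.
have [_ /andP[q3_gt0 q3_lt1]] := K_sub _ _ K3.
exists (Num.min p1 q2), q3; rewrite lt_min p1_gt0 q2_gt0 (ltW q3_gt0) q3_lt1.
split=> // p q /mem_set Kpq; rewrite !ge_min.
by rewrite (min1 _ Kpq) (min2 _ Kpq) (max3 _ Kpq) orbT.
Qed.

Lemma xstar_le_xk (R : realType) (k : nat) (p q : R) : 0 < p -> 0 < q ->
  (1 <= k)%N -> xstar p q <= xk k p q.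
Proof.
move=> p_gt0 q_gt0 k_gt0; apply: ge_inf; last by exists k.
exists 0 => _ [j _ <-].
by rewrite invr_ge0 mulr_ge0 ?sqr_ge0 // mulr_ge0 ?exprn_ge0 ?ltW.
Qed.

Theorem proposition7p5 (R : realType) (K : set (R * R)) (Y : R)
    (K_compact : compact K)
    (K_sub : forall p q : R, K (p, q) -> 0 < p < 1 /\ 0 < q < 1)
    (Y_ge0 : 0 <= Y) (eps : R) (eps_gt0 : 0 < eps)
    (eps_lt : (eps%:E < ereal_inf [set (xstar pq.1 pq.2)%:E | pq in K])%E) :
  exists C theta : R, 0 < theta < 1 /\
    forall (h : nat) (p q : R) (x y : R[i]),
      (1 <= h)%N -> K (p, q) ->
      `|y| <= real_complex R Y ->
      `|x| <= real_complex R (xstar p q - eps) ->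
      exists2 v : R[i],
        ratfun_value (ratfunG h y (real_complex R p) (real_complex R q)) x v &
        `|v| <= real_complex R (C * theta ^+ h).
Proof.
have [a [b [a_gt0 b_bnd K_bnd]]] := compact_unit_square_bounds K_compact K_sub.
(* The second term bounds 2 x' / eps, since x' <= 1 / a^2; the summand 1 ensures [1 <= M], as
   [dyckG_le] requires. *)
pose M := 1 + 2 / (a ^+ 2 * eps).
have M_ge1 : 1 <= M by rewrite lerDl divr_ge0 ?mulr_ge0 ?exprn_ge0 // ltW.
pose B := (a ^+ 2)^-1 * Y * M ^+ 2.
have B_ge0 : 0 <= B by rewrite !mulr_ge0 ?invr_ge0 ?exprn_ge0 ?(le_trans ler01 M_ge1) // ltW.
(* The extra factor 2 on [B] is what yields the ratio theta = 1/2. *)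
have [C C_bnd] := @expr_square_bounded R (2 * B) b (mulr_ge0 (ler0n _ 2) B_ge0) b_bnd.
exists C, 2^-1; split; first by lra.
move=> h p q x y h_gt0 Kpq le_y le_x.
have [/andP[p_gt0 _] /andP[q_gt0 _]] := K_sub _ _ Kpq.
have [le_ap le_aq le_qb] := K_bnd _ _ Kpq.
set s := xstar p q in le_x *.
have s_ge : 0 <= s - eps by have := le_trans (normr_ge0 x) le_x; rewrite lecR.
pose x' := s - eps / 2.
have x'_gt0 : 0 < x' by rewrite /x'; lra.
have x'_lt k : (1 <= k)%N -> 0 <= x' < xk k p q.
  move=> k_gt0; rewrite (ltW x'_gt0) (lt_le_trans _ (xstar_le_xk p_gt0 q_gt0 k_gt0)) //.
  by rewrite -/s /x'; lra.
(* For k = 1, positivity of T_2 reads 1 - x' p q > 0, so Lambda_2 need not be computed. *)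
have x'_le : x' <= (a ^+ 2)^-1.
  have := tridet_xk_gt0 p_gt0 q_gt0 (x'_lt 1%N isT) (leqnn 2).
  rewrite tridetSS /= expr0 expr1 mulr1 mul1r subr_gt0 => lt1.
  rewrite -[leRHS]mul1r ler_pdivlMr ?exprn_gt0 // (le_trans _ (ltW lt1)) //.
  by rewrite ler_pM2l // expr2 ler_pM // ltW.
pose sigma := (s - eps) / x'.
have sigma_bnd : 0 <= sigma < 1.
  by rewrite divr_ge0 // ?ltW //= ltr_pdivrMr // mul1r /x'; lra.
have sx' : sigma * x' = s - eps by rewrite divfK // gt_eqF.
have le_M : (1 - sigma)^-1 <= M.
  have -> : (1 - sigma)^-1 = x' * (2 / eps).
    have -> : 1 - sigma = eps / 2 / x'.
      rewrite -[1 in LHS](@divff _ x') ?gt_eqF // -mulrBl; congr (_ / _).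
      by rewrite /x'; lra.
    by rewrite !invfM !invrK; ring.
  rewrite /M invfM (mulrCA 2) (@le_trans _ _ ((a ^+ 2)^-1 * (2 / eps))) ?lerDr //.
  by rewrite ler_wpM2r // divr_ge0 // ltW.
have D_bnd k : (1 <= k)%N -> _ := fun k_gt0 =>
  dyckD_le p_gt0 q_gt0 k_gt0 (x'_lt k k_gt0) sigma_bnd (etrans (congr1 _ (congr1 _ sx')) le_x).
exists (dyckG h x y (real_complex R p) (real_complex R q)).
  by apply: ratfunG_value => // k /andP[k_gt0 _]; case: (D_bnd k k_gt0).
apply: (@le_trans _ _ (real_complex R (B ^+ h * b ^+ (h ^ 2)%N))); last first.
  rewrite lecR exprVn ler_pdivlMr ?exprn_gt0 // mulrC mulrA -exprMn.
  exact: C_bnd.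
have -> : real_complex R (B ^+ h * b ^+ (h ^ 2)%N) =
    (real_complex R (a ^+ 2)^-1 * real_complex R Y * real_complex R M ^+ 2) ^+ h *
    real_complex R b ^+ (h ^ 2)%N.
  by rewrite -!rmorphXn -!rmorphM -!rmorphXn -rmorphM.
apply: dyckG_le => //.
- by rewrite (le_trans le_x) // lecR; move: x'_le; rewrite /x'; lra.
- by rewrite ger0_norm ?lecR // ltW.
- by rewrite -(rmorph1 (real_complex R)) lecR.
- move=> k /andP[k_gt0 _]; case: (D_bnd k k_gt0) => _ /le_trans; apply.
  by rewrite lecR.
Qed.
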